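(* Let $(\mathscr{X},\|\cdot\|)$ be a real normed space and let $p\in[0,1)$. If there exists a positive real number $q$ such that $$\alpha_{p}[x,y]\leq 2^{\frac{1}{q}}\, \frac {\|x-y\|}{\left(\|x\|^{(1-p)q}+\|y\|^{(1-p)q}\right)^{\frac{1}{q}}}$$ for all nonzero $x,y\in\mathscr{X}$, then $(\mathscr{X},\|\cdot\|)$ is an inner product space.
   Context: For $p\in\mathbb{R}$ and nonzero elements $x,y$ of a normed space $(\mathscr{X},\|\cdot\|)$, the $p$-angular distance is $$\alpha_{p}[x,y]:=\left\|\frac{x}{\|x\|^{1-p}}-\frac{y}{\|y\|^{1-p}}\right\|.$$ Saying that $(\mathscr{X},\|\cdot\|)$ is an inner product space means that the norm $\|\cdot\|$ is induced by an inner product on $\mathscr{X}$, i.e. there is an inner product $\langle\cdot,\cdot\rangle$ on $\mathscr{X}$ with $\|x\|^2=\langle x,x\rangle$ for all $x\in\mathscr{X}$. No completeness or assumption on the dimension is made. *)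

(* Defs.v *)
From HB Require Import structures.
From mathcomp Require Import all_boot all_order all_algebra.
From mathcomp Require Import all_classical all_reals all_analysis.

Set Implicit Arguments.
Unset Strict Implicit.
Unset Printing Implicit Defensive.

Import Order.TTheory GRing.Theory Num.Theory.
Import numFieldNormedType.Exports.

Local Open Scope ring_scope.

(* Meaningful for x and y nonzero only. *)
Definition angular_distance (R : realType) (X : normedModType R) (p : R)
    (x y : X) : R :=
  `| (`|x| `^ (1 - p))^-1 *: x - (`|y| `^ (1 - p))^-1 *: y |.

(* Over a real field, [{dot X for idfun}] is the type of symmetric positive
   definite bilinear forms, i.e. of real inner products, on X. *)
Definition is_inner_product_space (R : realType) (X : normedModType R) : Prop :=
  exists dot : {dot X for idfun}, forall x : X, `|x| ^+ 2 = dot x x.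

(* Main.v *)
(* Put x = e^t u and y = - e^-t v with |u| = |v|. Since a power mean dominates
   the geometric mean, the hypothesis gives
   |e^(pt) u + e^(-pt) v| <= |e^t u + e^-t v|; iterating, and letting p^n t tend
   to 0, yields Lorch's condition |u + v| <= |r u + r^-1 v| for all r > 0.
   Hence |x + y| = |x - y| implies that x is Birkhoff orthogonal to y. In a
   plane, at a point x where the norm is smooth, all such y are parallel to one
   vector w, and the intermediate value theorem forces |x + w| = |x - w| for
   every multiple of w: the reflection fixing x and negating w is an isometry.
   It preserves the quadratic form of maximal determinant below the squared norm
   (the Loewner ellipse of the unit ball), which is unique, so it is an
   orthogonal reflection for that form. As smooth points are dense, the norm is
   invariant under all orthogonal reflections, hence constant on the ellipse.
   So the squared norm is a quadratic form on each plane. *)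

Require Import Defs.
From HB Require Import structures.
From mathcomp Require Import all_boot all_order all_algebra.
From mathcomp Require Import all_classical all_reals all_analysis.
From mathcomp Require Import ring lra.

Set Implicit Arguments.
Unset Strict Implicit.
Unset Printing Implicit Defensive.

Import Order.TTheory GRing.Theory Num.Theory.
Import numFieldNormedType.Exports.

Local Open Scope ring_scope.

(** * Planar norms: Lorch's condition, isosceles orthogonality and isometric reflections *)

Record planar_norm (R : realType) (N : R -> R -> R) : Prop := PlanarNorm {
  pnorm_ge0 : forall a b, 0 <= N a b;
  pnormZ : forall k a b, N (k * a) (k * b) = `|k| * N a b;
  pnormD : forall a b c d, N (a + c) (b + d) <= N a b + N c d;
  pnorm_eq0 : forall a b, N a b = 0 -> a = 0 /\ b = 0;
  pnorm_cvg : forall (f g : R -> R) (t : R),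
    {for t, continuous f} -> {for t, continuous g} ->
    {for t, continuous (fun s => N (f s) (g s))} }.

Definition lorch_property (R : realType) (N : R -> R -> R) : Prop :=
  forall a b c d r : R, 0 < r -> N a b = N c d ->
    N (a + c) (b + d) <= N (r * a + r^-1 * c) (r * b + r^-1 * d).

Lemma pnormN (R : realType) (N : R -> R -> R) (hN : planar_norm N) (a b : R) :
  N (- a) (- b) = N a b.
Proof. by rewrite -mulN1r -[- b]mulN1r pnormZ// normrN1 mul1r. Qed.

Lemma pnorm_gt0 (R : realType) (N : R -> R -> R) (hN : planar_norm N)
    (a b : R) : 0 < a ^+ 2 + b ^+ 2 -> 0 < N a b.
Proof.
move=> ab0; rewrite lt_def (pnorm_ge0 hN) andbT.
apply: contraTneq ab0 => /(pnorm_eq0 hN)[-> ->].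
by rewrite expr0n addr0 ltxx.
Qed.

Lemma pnorm_line_continuous (R : realType) (N : R -> R -> R)
    (hN : planar_norm N) (a b c d : R) :
  continuous (fun t : R => N (a + t * c) (b + t * d)).
Proof.
move=> t.
apply: (@pnorm_cvg _ _ hN (fun t => a + t * c) (fun t => b + t * d)).
  by apply: cvgD; [exact: cvg_cst | apply: cvgMl; exact: cvg_id].
by apply: cvgD; [exact: cvg_cst | apply: cvgMl; exact: cvg_id].
Qed.

(** Lorch's condition is applied to the sum and the difference of the two vectors. The result is
    Birkhoff orthogonality up to an error of second order in [s]. *)
Lemma isosceles_birkhoff (R : realType) (N : R -> R -> R) (hN : planar_norm N)
    (hL : lorch_property N) (a b c d s : R) :
  N (a + c) (b + d) = N (a - c) (b - d) -> -1 < s < 1 ->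
  (1 - s ^+ 2) * N a b <= N (a + s * c) (b + s * d).
Proof.
move=> iso /andP[s1 s2].
have hs : 0 < 1 - s ^+ 2 by nra.
(* For r = (1 + s)/k the inverse is (1 - s)/k, and r(x + y) + r^-1(x - y) is 2/k times x + s y. This
   gives the bound with k in place of k^2, which is stronger because k <= 1. *)
set k := Num.sqrt (1 - s ^+ 2).
have k0 : 0 < k by rewrite sqrtr_gt0.
have k2 : k ^+ 2 = 1 - s ^+ 2 by rewrite sqr_sqrtr// ltW.
have kn0 : k != 0 by rewrite gt_eqF.
have r0 : 0 < (1 + s) / k by rewrite divr_gt0//; lra.
have rV : ((1 + s) / k)^-1 = (1 - s) / k.
  have s1' : 1 + s != 0 by apply/eqP; lra.
  rewrite invf_div; apply/eqP; rewrite eqr_div //.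
  by apply/eqP; transitivity (k ^+ 2); [ring | rewrite k2; ring].
have := hL _ _ _ _ _ r0 iso; rewrite rV.
have -> : a + c + (a - c) = 2 * a by ring.
have -> : b + d + (b - d) = 2 * b by ring.
have -> : (1 + s) / k * (a + c) + (1 - s) / k * (a - c) = (2 / k) * (a + s * c).
  by field.
have -> : (1 + s) / k * (b + d) + (1 - s) / k * (b - d) = (2 / k) * (b + s * d).
  by field.
have q0 : 0 < 2 / k by rewrite divr_gt0.
rewrite !pnormZ// normr_nat (gtr0_norm q0) => le1.
have := ler_wpM2l (ltW k0) le1.
have -> : k * (2 / k * N (a + s * c) (b + s * d)) = 2 * N (a + s * c) (b + s * d).
  by field.
have k1 : k <= 1 by nra.
have := pnorm_ge0 hN a b; rewrite -k2 => n0 le2.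
have : k ^+ 2 * N a b <= k * N a b by rewrite ler_wpM2r//; nra.
by lra.
Qed.

(** The parabolic bound makes the derivative of the norm at x = (a, b) along y = (c, d) vanish. If
    N(x + y) and N(x - y) differed, x would, up to the sign of y, be isosceles orthogonal to some (1
    - t) x + t y with t < 1; its component along x changes the norm at first order, against
    [isosceles_birkhoff]. *)
Lemma second_order_isosceles (R : realType) (N : R -> R -> R)
    (hN : planar_norm N) (hL : lorch_property N) (a b c d C eta : R) :
  0 < N a b -> 0 <= C -> 0 < eta ->
  (forall s, `|s| < eta ->
     N (a + s * c) (b + s * d) <= N a b + C * s ^+ 2) ->
  N (a + c) (b + d) = N (a - c) (b - d).
Proof.
move=> n0 C0 eta0 bnd.
suff half c' d' : (forall s, `|s| < eta ->
     N (a + s * c') (b + s * d') <= N a b + C * s ^+ 2) ->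
     N (a - c') (b - d') <= N (a + c') (b + d').
  apply/eqP; rewrite eq_le half // andbT.
  have := half (- c) (- d); rewrite !opprK; apply=> s hs.
  have := bnd (- s); rewrite normrN sqrrN => /(_ hs).
  by rewrite !mulNr -!mulrN.
move=> {}bnd; rewrite leNgt; apply/negP => neg.
(* [phi] compares N(x + z) with N(x - z) while z moves from x to y; at a zero, x is isosceles
   orthogonal to z. *)
pose phi t := N (a + ((1 - t) * a + t * c')) (b + ((1 - t) * b + t * d'))
            - N (a - ((1 - t) * a + t * c')) (b - ((1 - t) * b + t * d')).
have phi_cont : continuous phi.
  have -> : phi = (fun t => N (2 * a + t * (c' - a)) (2 * b + t * (d' - b))
                          - N (0 + t * (a - c')) (0 + t * (b - d'))).
    by apply/funext => t; rewrite /phi; congr (N _ _ - N _ _); ring.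
  by move=> t; apply: cvgB; exact: pnorm_line_continuous.
have phi0 : 0 < phi 0.
  rewrite /phi !subr0 !mul1r !mul0r !addr0 !subrr -[a + a]mulr2n -[b + b]mulr2n.
  rewrite -[X in N X X](mul0r 0) pnormZ// normr0 mul0r subr0.
  by rewrite -[a *+ 2]mulr_natl -[b *+ 2]mulr_natl pnormZ// mulr_gt0// normr_gt0.
have phi1 : phi 1 < 0 by rewrite /phi !subrr !mul0r !mul1r !add0r subr_lt0.
have [||t] := @IVT R phi 0 1 0 ler01; first exact: continuous_subspaceT.
  by rewrite ge_min le_max (ltW phi0) (ltW phi1) orbT.
rewrite in_itv/= => /andP[t0 t1] phit.
have t1' : t < 1.
  by rewrite lt_neqAle t1 andbT; apply: contraTneq phi1 => <-; rewrite phit ltxx.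
move: phit; rewrite /phi => /eqP; rewrite subr_eq0 => /eqP iso.
set n := N a b in n0 bnd *.
have nC : 0 < n + 2 * C by lra.
(* The first bound keeps [k] below at least 1/2, the second keeps the parameter h t / k within
   [eta], and the third makes the second-order error h^2 (n + 2 C) smaller than the first-order loss
   h (1 - t) n. *)
pose h := Num.min (1 / 2) (Num.min (eta / 3) ((1 - t) * n / (2 * (n + 2 * C)))).
have h0 : 0 < h by rewrite /h !lt_min !divr_gt0 ?mulr_gt0 ?subr_gt0//; lra.
have h1 : h <= 1 / 2 by rewrite /h ge_min lexx.
have h2 : h <= eta / 3 by rewrite /h !ge_min lexx orbT.
have h3 : h * (2 * (n + 2 * C)) <= (1 - t) * n.
  rewrite -ler_pdivlMr; last by lra.
  by rewrite /h !ge_min lexx !orbT.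
have h11 : -1 < - h < 1 by apply/andP; split; lra.
have := isosceles_birkhoff hN hL iso h11.
set k := 1 - h * (1 - t).
have k0 : 1 / 2 <= k by rewrite /k; nra.
have kn : k != 0 by apply/eqP; lra.
have -> : a + - h * ((1 - t) * a + t * c') = k * (a + - (h * t / k) * c').
  by rewrite /k; field.
have -> : b + - h * ((1 - t) * b + t * d') = k * (b + - (h * t / k) * d').
  by rewrite /k; field.
rewrite pnormZ// ger0_norm; last lra.
have small : h * t / k <= 2 * h by rewrite ler_pdivrMr; nra.
have pos : 0 <= h * t / k by rewrite divr_ge0//; nra.
have hlt : `|- (h * t / k)| < eta by rewrite normrN ger0_norm//; lra.
have b1 := bnd _ hlt.
have k0' : 0 <= k by lra.
have := ler_wpM2l k0' b1; rewrite -/n !sqrrN.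
have : C * (k * (h * t / k) ^+ 2) <= C * (2 * h ^+ 2).
  apply: ler_wpM2l => //.
  have -> : k * (h * t / k) ^+ 2 = (h * t) * (h * t / k) by field.
  have ht : h * t <= h by nra.
  have ht0 : 0 <= h * t by nra.
  nra.
rewrite -/n.
move: (N _ (b + - _ * _)) ((h * t / k) ^+ 2) => Z W q1 q2 q3.
have : (1 - h ^+ 2) * n <= k * n + C * (2 * h ^+ 2).
  apply: (le_trans q3); apply: (le_trans q2).
  by rewrite mulrDr lerD2l mulrCA.
have tn : 0 < h * ((1 - t) * n) by rewrite !mulr_gt0// subr_gt0.
have := ler_wpM2l (ltW h0) h3.
rewrite /k => q4 q5.
lra.
Qed.

(** The parabolic bound survives rescaling of (c, d), with new constants, so
    [second_order_isosceles] applies to every multiple of it; homogeneity does the rest. *)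
Lemma smooth_reflection (R : realType) (N : R -> R -> R) (hN : planar_norm N)
    (hL : lorch_property N) (a b c d C eta : R) :
  0 < N a b -> 0 <= C -> 0 < eta ->
  (forall s, `|s| < eta ->
     N (a + s * c) (b + s * d) <= N a b + C * s ^+ 2) ->
  forall u v, N (u * a + v * c) (u * b + v * d) = N (u * a - v * c) (u * b - v * d).
Proof.
move=> n0 C0 eta0 bnd u v; have [->|u0] := eqVneq u 0.
  by rewrite !mul0r !add0r pnormN.
have scaled w : N (a + w * c) (b + w * d) = N (a - w * c) (b - w * d).
  have w0 : 0 < `|w| + 1 by rewrite ltr_wpDl.
  apply: (second_order_isosceles hN hL (C := C * w ^+ 2) (eta := eta / (`|w| + 1))) => //.
  - by rewrite mulr_ge0// sqr_ge0.
  - by rewrite divr_gt0.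
  move=> s; rewrite ltr_pdivlMr// => hs.
  rewrite !(mulrA s) -[C * _ * s ^+ 2]mulrA -exprMn [w * s]mulrC.
  apply: bnd; rewrite normrM; apply: le_lt_trans hs.
  by rewrite ler_wpM2l// lerDl.
have -> : u * a + v * c = u * (a + (v / u) * c) by field.
have -> : u * b + v * d = u * (b + (v / u) * d) by field.
have -> : u * a - v * c = u * (a - (v / u) * c) by field.
have -> : u * b - v * d = u * (b - (v / u) * d) by field.
by rewrite !pnormZ// scaled.
Qed.

(* At a maximum [t] of [N (x + t y) - C t ^ 2] the norm is bounded above by a
   parabola along the line; subtracting from [y] the multiple [k] of [x + t y]
   that absorbs the linear term leaves only the quadratic one. *)
Lemma reflections_dense (R : realType) (N : R -> R -> R) (hN : planar_norm N)
    (hL : lorch_property N) (a b c d delta : R) :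
  (forall t, 0 < N (a + t * c) (b + t * d)) -> 0 < delta ->
  exists t k : R, `|t| < delta /\ forall u v,
    N (u * (a + t * c) + v * (c - k * (a + t * c)))
      (u * (b + t * d) + v * (d - k * (b + t * d))) =
    N (u * (a + t * c) - v * (c - k * (a + t * c)))
      (u * (b + t * d) - v * (d - k * (b + t * d))).
Proof.
move=> npos d0.
pose h t := N (a + t * c) (b + t * d).
(* With this [C], at t = delta and t = - delta the penalty C t^2 exceeds the largest possible growth
   of [h] from 0, so the maximum is attained in the interior. *)
pose C := (N c d + 1) / delta.
have Cd : C * delta = N c d + 1 by rewrite /C; field; rewrite gt_eqF.
have ncd := pnorm_ge0 hN c d.
have C0 : 0 < C by rewrite divr_gt0// ltr_wpDl.
have cont : continuous (fun t => h t - C * t ^+ 2).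
  move=> t; apply: cvgB; first exact: pnorm_line_continuous.
  by apply: cvgMr; exact: exprn_continuous.
have dd : - delta <= delta by lra.
have [t tin tmax] := EVT_max dd (continuous_subspaceT cont).
have {}tmax s : - delta <= s <= delta -> h s <= h t + C * (s ^+ 2 - t ^+ 2).
  by move=> hs; have := tmax s; rewrite in_itv/= => /(_ hs); lra.
have lip s : h s <= h 0 + `|s| * N c d.
  rewrite /h !mul0r !addr0 -pnormZ//; exact: pnormD.
have td : `|t| < delta.
  move: tin; rewrite in_itv/= -ler_norml le_eqVlt => /orP[/eqP te|//].
  have := tmax 0; have -> : - delta <= 0 <= delta by apply/andP; split; lra.
  move=> /(_ isT); have := lip t.
  rewrite -(real_normK (num_real t)) te expr0n sub0r => l1 l2.
  have : C * delta ^+ 2 = delta * N c d + delta by rewrite expr2 mulrA Cd; ring.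
  by lra.
pose n := h t; have n0 : 0 < n := npos t.
pose k := 2 * C * t / n.
have kn : k * n = 2 * C * t by rewrite /k; field; rewrite gt_eqF.
exists t, k; split => //.
(* [e1] ensures |s k| <= 1/2, hence 1 - s k >= 1/2; the other bound in [eta] keeps t + s / (1 - s k)
   in the interval where [t] is the maximum. *)
pose e1 := 1 / (2 * (`|k| + 1)).
have k1 : 0 < `|k| + 1 by rewrite ltr_wpDl.
have e10 : 0 < e1 by rewrite divr_gt0// mulr_gt0.
have e1k : e1 * (`|k| + 1) = 1 / 2 by rewrite /e1; field; rewrite gt_eqF.
pose eta := Num.min e1 ((delta - `|t|) / 2).
have eta0 : 0 < eta by rewrite lt_min e10 divr_gt0// subr_gt0.
apply: (smooth_reflection hN hL (C := 2 * C) (eta := eta)) => //.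
  by rewrite mulr_ge0// ltW.
move=> s; rewrite lt_min => /andP[se1 se2].
have sk : `|s * k| <= 1 / 2.
  rewrite normrM -e1k; apply: ler_pM => //; first exact: ltW.
  by rewrite lerDl.
pose l := 1 - s * k.
have l1 : 1 / 2 <= l by move: sk; rewrite ler_norml => /andP[_]; rewrite /l; lra.
have l0 : l != 0 by apply/eqP; lra.
have lge0 : 0 <= l by lra.
have -> : a + t * c + s * (c - k * (a + t * c)) = l * (a + (t + s / l) * c).
  by rewrite /l; field.
have -> : b + t * d + s * (d - k * (b + t * d)) = l * (b + (t + s / l) * d).
  by rewrite /l; field.
rewrite pnormZ// ger0_norm// -/(h (t + s / l)) -/(h t).
have sl : `|s / l| <= 2 * `|s|.
  rewrite normrM normfV (ger0_norm lge0) ler_pdivrMr; last lra.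
  by have := normr_ge0 s; nra.
have inside : - delta <= t + s / l <= delta.
  rewrite -ler_norml; apply: le_trans (ler_normD _ _) _; lra.
have := ler_wpM2l lge0 (tmax _ inside).
have -> : l * (h t + C * ((t + s / l) ^+ 2 - t ^+ 2)) =
  l * n + 2 * C * t * s + C * (s ^+ 2 / l) by rewrite /n; field.
have -> : l * n + 2 * C * t * s = n by rewrite -kn /l; ring.
move=> /le_trans; apply; rewrite lerD2l.
have -> : 2 * C * s ^+ 2 = C * (2 * s ^+ 2) by ring.
rewrite ler_pM2l//.
rewrite ler_pdivrMr; last lra.
by have := sqr_ge0 s; nra.
Qed.

(** * The Loewner ellipse of the unit ball, as a quadratic form of maximal determinant *)

Definition quadratic_form (R : realType) (A B C a b : R) : R :=
  A * a ^+ 2 + 2 * B * a * b + C * b ^+ 2.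

(** The signs of A and C exclude negative definite forms, which also lie below the squared norm and
    have positive, unbounded determinants. *)
Definition inner_form (R : realType) (N : R -> R -> R) (A B C : R) : Prop :=
  0 <= A /\ 0 <= C /\ forall a b, quadratic_form A B C a b <= N a b ^+ 2.

(** The ellipse of the form contains the unit ball of [N], and its area decreases as the determinant
    grows: this is the containing ellipse of least area. *)
Definition maximal_form (R : realType) (N : R -> R -> R) (A B C : R) : Prop :=
  [/\ inner_form N A B C, 0 < A * C - B ^+ 2 &
    forall A' B' C', inner_form N A' B' C' ->
      A' * C' - B' ^+ 2 <= A * C - B ^+ 2].

Lemma pnorm_lower_bound (R : realType) (N : R -> R -> R) (hN : planar_norm N) :
  exists2 m, 0 < m & forall a b, m * `|b| <= N a b.
Proof.
have n10 : 0 < N 1 0 by apply: pnorm_gt0 => //; nra.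
have n01 : 0 < N 0 1 by apply: pnorm_gt0 => //; nra.
(* For |a| > M the triangle inequality already gives N a 1 >= N 0 1; on [-M, M] compactness provides
   a minimum. *)
pose M := 2 * N 0 1 / N 1 0.
have MM : M * N 1 0 = 2 * N 0 1 by rewrite /M; field; rewrite gt_eqF.
have M0 : 0 < M by rewrite divr_gt0// mulr_gt0.
have MM' : - M <= M by lra.
have cont : continuous (fun t : R => N (0 + t * 1) (1 + t * 0)).
  exact: pnorm_line_continuous.
have [t _ tmin] := EVT_min MM' (continuous_subspaceT cont).
pose m := Num.min (N (0 + t * 1) (1 + t * 0)) (N 0 1).
have m0 : 0 < m by rewrite lt_min n01 andbT; apply: pnorm_gt0 => //; nra.
have low a : m <= N a 1.
  rewrite /m ge_min; have [aM|aM] := leP `|a| M.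
    have := tmin a; rewrite in_itv/= -ler_norml => /(_ aM).
    by rewrite !add0r !mulr1 !mulr0 !addr0 => ->.
  apply/orP; right.
  have := pnormD hN a 1 0 (- 1).
  rewrite addr0 subrr -[X in N X (- 1)]oppr0 pnormN//.
  have := pnormZ hN a 1 0; rewrite mulr1 mulr0 => ->.
  by nra.
exists m => // a b; have [->|b0] := eqVneq b 0.
  by rewrite normr0 mulr0 pnorm_ge0.
have -> : a = b * (a / b) by field.
rewrite -[X in N _ X](mulr1 b) pnormZ// mulrC.
by rewrite ler_wpM2l.
Qed.

Lemma planar_norm_swap (R : realType) (N : R -> R -> R) :
  planar_norm N -> planar_norm (fun a b => N b a).
Proof.
case=> h1 h2 h3 h4 h5; split => //.
- by move=> a b /h4[].
- by move=> f g t fc gc; exact: h5.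
Qed.

(** Averaging the lower bounds for the two coordinates gives a competitor of positive determinant,
    so the maximal determinant is positive. *)
Lemma positive_inner_form (R : realType) (N : R -> R -> R)
    (hN : planar_norm N) : exists A C, [/\ 0 < A, 0 < C & inner_form N A 0 C].
Proof.
have [m m0 hm] := pnorm_lower_bound hN.
have [l l0 hl] := pnorm_lower_bound (planar_norm_swap hN).
exists (l ^+ 2 / 2), (m ^+ 2 / 2); split; [nra|nra|].
split; [nra|split; [nra|]] => a b; rewrite /quadratic_form.
have := hm a b; have := hl b a => /= h1 h2.
have h1' : l ^+ 2 * a ^+ 2 <= N a b ^+ 2.
  rewrite -[a ^+ 2](real_normK (num_real a)) -exprMn lerXn2r// nnegrE.
    by rewrite mulr_ge0// ltW.
  exact: pnorm_ge0.
have h2' : m ^+ 2 * b ^+ 2 <= N a b ^+ 2.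
  rewrite -[b ^+ 2](real_normK (num_real b)) -exprMn lerXn2r// nnegrE.
    by rewrite mulr_ge0// ltW.
  exact: pnorm_ge0.
by lra.
Qed.

Lemma exists_maximal_form (R : realType) (N : R -> R -> R)
    (hN : planar_norm N) : exists A B C, maximal_form N A B C.
Proof.
(* The bounds come from evaluating the form at (1, 0), (0, 1), (1, 1) and (1, -1); those on B use
   that A and C are nonnegative. *)
pose box : set (R * R * R) :=
  ((`[0, N 1 0 ^+ 2] `*` `[- (N 1 (- 1) ^+ 2), N 1 1 ^+ 2]) `*` `[0, N 0 1 ^+ 2])%classic.
pose F : set (R * R * R) :=
  [set x | forall a b, quadratic_form x.1.1 x.1.2 x.2 a b <= N a b ^+ 2]%classic.
have boxc : compact box.
  by apply: compact_setX; [apply: compact_setX|]; exact: segment_compact.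
have coord : [/\ continuous (fun x : R * R * R => x.1.1),
     continuous (fun x : R * R * R => x.1.2) &
     continuous (fun x : R * R * R => x.2)].
  split=> x; last exact: cvg_snd.
    by apply: continuous_comp; [exact: cvg_fst|exact: cvg_fst].
  by apply: continuous_comp; [exact: cvg_fst|exact: cvg_snd].
case: coord => c1 c2 c3.
have Fc : closed F.
  have -> : F = (\bigcap_(p in setT) [set x : R * R * R |
      quadratic_form x.1.1 x.1.2 x.2 p.1 p.2 <= N p.1 p.2 ^+ 2])%classic.
    apply/seteqP; split => x /= hx; first by move=> p _; exact: hx.
    by move=> a b; exact: (hx (a, b) I).
  apply: closed_bigI => p _.
  apply: (@preimage_closed _ _ (fun x : R * R * R => quadratic_form x.1.1 x.1.2 x.2 p.1 p.2)
     [set y | y <= N p.1 p.2 ^+ 2]%classic); last exact: closed_le.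
  move=> x _; rewrite /quadratic_form.
  apply: cvgD; [apply: cvgD|].
  - by apply: cvgMl; exact: c1.
  - apply: cvgMl; apply: cvgMl; apply: cvgMr; exact: c2.
  - by apply: cvgMl; exact: c3.
have Kc : compact (box `&` F)%classic by exact: compact_closedI.
have inK A B C : inner_form N A B C -> (box `&` F)%classic (A, B, C).
  move=> [A0 [C0 hf]]; split => //=.
  have := hf 1 0; have := hf 0 1; have := hf 1 1; have := hf 1 (- 1).
  rewrite /quadratic_form => h1 h2 h3 h4.
  rewrite /box /= !in_itv/= A0 C0 /=.
  have sq a b : 0 <= N a b ^+ 2 by exact: sqr_ge0.
  have s1 := sq 1 1; have s2 := sq 1 (- 1).
  by split; [split; [lra|apply/andP; split; lra]|lra].
have [A0 [C0 [A0p C0p hAC]]] := positive_inner_form hN.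
have detc : continuous (fun x : R * R * R => x.1.1 * x.2 - x.1.2 ^+ 2).
  move=> x; apply: cvgB; first by apply: cvgM; [exact: c1|exact: c3].
  by apply: (@continuous_comp _ _ _ (fun x : R * R * R => x.1.2) (fun y => y ^+ 2));
    [exact: c2|exact: exprn_continuous].
have K0 : (box `&` F !=set0)%classic by exists (A0, 0, C0); exact: inK.
have [[[A B] C]] := compact_EVT_max K0 Kc (continuous_subspaceT detc).
rewrite inE => -[[[/= hA _] hC] hF] hmax.
have {}hmax A' B' C' : inner_form N A' B' C' ->
    A' * C' - B' ^+ 2 <= A * C - B ^+ 2.
  by move=> hi; have := hmax (A', B', C'); rewrite inE; apply; exact: inK.
exists A, B, C; split => //.
  move: hA hC; rewrite /= !in_itv/= => /andP[? _] /andP[? _].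
  by split=> //; split.
by apply: lt_le_trans (hmax _ _ _ hAC); nra.
Qed.

Definition polar_form (R : realType) (A B C a b c d : R) : R :=
  A * a * c + B * (a * d + b * c) + C * b * d.

Lemma sum_sqr_le0 (R : realType) (x y : R) :
  x ^+ 2 + y ^+ 2 <= 0 -> x = 0 /\ y = 0.
Proof.
by move=> xy; split; apply/eqP; rewrite -sqrf_eq0; apply/eqP; nra.
Qed.

Lemma maximal_form_gt0 (R : realType) (N : R -> R -> R) (A B C : R) :
  maximal_form N A B C -> 0 < A /\ 0 < C.
Proof.
case=> -[A0 [C0 _]] D0 _; split; rewrite lt_def ?A0 ?C0 andbT;
  apply: contraTneq D0 => ->; rewrite ?mul0r ?mulr0 sub0r oppr_gt0 -leNgt sqr_ge0//.
Qed.

Lemma quadratic_form_gt0 (R : realType) (N : R -> R -> R) (A B C a b : R) :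
  maximal_form N A B C -> 0 < a ^+ 2 + b ^+ 2 -> 0 < quadratic_form A B C a b.
Proof.
move=> hm ab; have [A0 C0] := maximal_form_gt0 hm; case: hm => _ D0 _.
rewrite -(pmulr_rgt0 _ A0) /quadratic_form.
have -> : A * (A * a ^+ 2 + 2 * B * a * b + C * b ^+ 2) =
  (A * a + B * b) ^+ 2 + (A * C - B ^+ 2) * b ^+ 2 by ring.
have [b0|b0] := eqVneq b 0.
  move: ab; rewrite b0 expr0n addr0 !mulr0 !addr0 exprMn => a0.
  by rewrite mulr_gt0// exprn_gt0.
have b2 : 0 < b ^+ 2 by rewrite exprn_even_gt0.
by rewrite ltr_wpDl ?sqr_ge0// mulr_gt0.
Qed.

(* The determinant is strictly log-concave on positive definite forms: the
   midpoint of two distinct maximal forms would have a larger determinant. *)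
Lemma maximal_form_unique (R : realType) (N : R -> R -> R) (A B C A' B' C' : R) :
  maximal_form N A B C -> inner_form N A' B' C' ->
  A' * C' - B' ^+ 2 = A * C - B ^+ 2 -> [/\ A' = A, B' = B & C' = C].
Proof.
move=> hm hi detE; have [A0 C0] := maximal_form_gt0 hm.
case: hm => -[_ [_ hf]] D0 hmax.
have [A'0 [C'0 hf']] := hi.
have A'p : 0 < A'.
  rewrite lt_def A'0 andbT; apply: contraTneq D0 => A'E.
  by rewrite -detE A'E mul0r sub0r oppr_gt0 -leNgt sqr_ge0.
have mid : inner_form N ((A + A') / 2) ((B + B') / 2) ((C + C') / 2).
  split; [lra|split; [lra|]] => a b.
  have := hf a b; have := hf' a b; rewrite /quadratic_form => h1 h2.
  by lra.
have := hmax _ _ _ mid.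
set D := A * C - B ^+ 2 in D0 detE *.
(* Eliminating C and C' through the common determinant [D] turns the excess of the midpoint's
   determinant over [D] into a sum of squares, which maximality forces to vanish. *)
have CE : C = (D + B ^+ 2) / A by rewrite /D; field; rewrite gt_eqF.
have C'E : C' = (D + B' ^+ 2) / A' by rewrite -detE; field; rewrite gt_eqF.
have AA : 0 < A * A' by rewrite mulr_gt0.
have key : (A + A') / 2 * ((C + C') / 2) - ((B + B') / 2) ^+ 2 - D =
  (D * (A - A') ^+ 2 + (A * B' - A' * B) ^+ 2) / (4 * (A * A')).
  by rewrite CE C'E; field; rewrite !gt_eqF.
rewrite -subr_le0 key pmulr_lle0; last by rewrite invr_gt0 mulr_gt0.
move=> le0.
have s1 : 0 <= (A * B' - A' * B) ^+ 2 by exact: sqr_ge0.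
have s2 : 0 <= D * (A - A') ^+ 2 by rewrite mulr_ge0 ?sqr_ge0// ltW.
have e2 : D * (A - A') ^+ 2 = 0 by lra.
have e1 : (A * B' - A' * B) ^+ 2 = 0 by lra.
have AE : A' = A.
  move/eqP: e2; rewrite mulf_eq0 (gt_eqF D0) /= sqrf_eq0 subr_eq0.
  by move=> /eqP.
have BE : B' = B.
  move/eqP: e1; rewrite sqrf_eq0 AE -mulrBr mulf_eq0 (gt_eqF A0) /= subr_eq0.
  by move=> /eqP.
by split=> //; rewrite C'E CE AE BE.
Qed.

(** * Invariance of the norm under the orthogonal reflections of the maximal form *)

Lemma reflection_orthogonal (R : realType) (N : R -> R -> R)
    (A B C a b c d : R) :
  maximal_form N A B C -> a * d - b * c != 0 ->
  (forall u v, N (u * a + v * c) (u * b + v * d) =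
               N (u * a - v * c) (u * b - v * d)) ->
  polar_form A B C a b c d = 0.
Proof.
move=> hm; set D := a * d - b * c => D0 sym.
(* Matrix entries, in the standard basis, of the reflection fixing (a, b) and negating (c, d). *)
pose al := (a * d + b * c) / D; pose be := (- (2 * a * c)) / D.
pose ga := (2 * b * d) / D; pose de := (- (a * d + b * c)) / D.
have Nsig x y : N (al * x + be * y) (ga * x + de * y) = N x y.
  have := sym ((d * x - c * y) / D) ((a * y - b * x) / D).
  have -> : (d * x - c * y) / D * a + (a * y - b * x) / D * c = x.
    by rewrite /D; field.
  have -> : (d * x - c * y) / D * b + (a * y - b * x) / D * d = y.
    by rewrite /D; field.
  by move=> ->; congr N; rewrite /al /be /ga /de; field.
have Qpos x y : 0 <= quadratic_form A B C x y.
  have [A0 C0] := maximal_form_gt0 hm.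
  have [xy|xy] := ltP 0 (x ^+ 2 + y ^+ 2).
    by rewrite ltW// (quadratic_form_gt0 hm).
  have [x0 y0] := sum_sqr_le0 xy.
  by rewrite /quadratic_form x0 y0; lra.
(* The pullback of the form by the reflection. It stays below the squared norm since the reflection
   is an isometry, and keeps its determinant since the reflection has determinant -1; uniqueness
   makes the two forms equal. *)
pose A' := quadratic_form A B C al ga.
pose B' := polar_form A B C al ga be de.
pose C' := quadratic_form A B C be de.
have Q'E x y : quadratic_form A' B' C' x y =
    quadratic_form A B C (al * x + be * y) (ga * x + de * y).
  by rewrite /A' /B' /C' /quadratic_form /polar_form; ring.
have hi : inner_form N A' B' C'.
  split; [exact: Qpos|split; [exact: Qpos|]] => x y.
  by rewrite Q'E -Nsig; case: hm => -[_ [_ hf]] _ _; exact: hf.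
have detE : A' * C' - B' ^+ 2 = A * C - B ^+ 2.
  have -> : A' * C' - B' ^+ 2 = (A * C - B ^+ 2) * (al * de - be * ga) ^+ 2.
    by rewrite /A' /B' /C' /quadratic_form /polar_form; ring.
  have -> : al * de - be * ga = - 1 by rewrite /al /be /ga /de /D; field.
  by ring.
have [AE BE CE] := maximal_form_unique hm hi detE.
(* The reflection sends x + y to x - y, so the form agrees on both and its polar form vanishes at
   (x, y). *)
have := Q'E (a + c) (b + d); rewrite AE BE CE.
have -> : al * (a + c) + be * (b + d) = a - c by rewrite /al /be /D; field.
have -> : ga * (a + c) + de * (b + d) = b - d by rewrite /ga /de /D; field.
by rewrite /quadratic_form /polar_form => h; lra.
Qed.

(** The vector on the left is the orthogonal reflection of (c, d) across the line of (a, b).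
    Directions arbitrarily near (a, b) carry isometric reflections, orthogonal by
    [reflection_orthogonal]; continuity passes to the limit. *)
Lemma maximal_form_reflection (R : realType) (N : R -> R -> R)
    (hN : planar_norm N) (hL : lorch_property N) (A B C a b c d : R) :
  maximal_form N A B C -> 0 < a ^+ 2 + b ^+ 2 ->
  let k := 2 * polar_form A B C c d a b / quadratic_form A B C a b in
  N (k * a - c) (k * b - d) = N c d.
Proof.
move=> hm ab0 k.
(* The direction is varied along the Euclidean normal (- b, a), so that it never vanishes. *)
pose X t : R := a + t * - b; pose Y t : R := b + t * a.
have XY t : 0 < X t ^+ 2 + Y t ^+ 2.
  have -> : X t ^+ 2 + Y t ^+ 2 = (1 + t ^+ 2) * (a ^+ 2 + b ^+ 2).
    by rewrite /X /Y; ring.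
  by rewrite mulr_gt0// ltr_pwDl// sqr_ge0.
pose K t := 2 * polar_form A B C c d (X t) (Y t) / quadratic_form A B C (X t) (Y t).
pose G t := N (K t * X t - c) (K t * Y t - d).
have dense delta : 0 < delta -> exists2 t, `|t| < delta & G t = N c d.
  move=> d0.
  have np t : 0 < N (X t) (Y t) by exact: pnorm_gt0.
  have [t [q [td sym]]] := reflections_dense hN hL np d0.
  exists t => //.
  move: sym; rewrite -/(X t) -/(Y t).
  set r := - b - q * X t; set s := a - q * Y t => sym.
  have DE : X t * s - Y t * r = a ^+ 2 + b ^+ 2 by rewrite /r /s /X /Y; ring.
  have D0 : X t * s - Y t * r != 0 by rewrite DE gt_eqF.
  have orth := reflection_orthogonal hm D0 sym.
  have Qp := quadratic_form_gt0 hm (XY t).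
  move: orth Qp D0 sym; rewrite /G /K; move: (X t) (Y t) => x y orth Qp D0 sym.
  (* Coordinates of (c, d) in the basis (x, y), (r, s). Orthogonality of this basis reduces the
     reflection coefficient to 2 u, so the reflection only changes the sign of [v]. *)
  pose u := (c * s - d * r) / (x * s - y * r).
  pose v := (x * d - y * c) / (x * s - y * r).
  have cE : c = u * x + v * r by rewrite /u /v; field.
  have dE : d = u * y + v * s by rewrite /u /v; field.
  have -> : 2 * polar_form A B C c d x y / quadratic_form A B C x y = 2 * u.
    have -> : polar_form A B C c d x y =
        u * quadratic_form A B C x y + v * polar_form A B C x y r s.
      by rewrite {1}cE {1}dE /polar_form /quadratic_form; ring.
    by rewrite orth mulr0 addr0; field; rewrite gt_eqF.
  rewrite [RHS](_ : _ = N (u * x + v * r) (u * y + v * s)) -?cE -?dE//.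
  rewrite [in RHS]cE [in RHS]dE sym.
  by congr N; [rewrite {1}cE | rewrite {1}dE]; ring.
have contG : {for 0, continuous G}.
  have Xc : continuous X.
    by move=> t; apply: cvgD; [exact: cvg_cst | apply: cvgMl; exact: cvg_id].
  have Yc : continuous Y.
    by move=> t; apply: cvgD; [exact: cvg_cst | apply: cvgMl; exact: cvg_id].
  have Kc : {for 0, continuous K}.
    apply: cvgM.
      apply: cvgMr; apply: cvgD; [apply: cvgD|].
      - by apply: cvgMr; exact: Xc.
      - by apply: cvgMr; apply: cvgD; apply: cvgMr; [exact: Yc|exact: Xc].
      - by apply: cvgMr; exact: Yc.
    apply: cvgV; first by rewrite gt_eqF// (quadratic_form_gt0 hm).
    apply: cvgD; [apply: cvgD|].
    - by apply: cvgMr; apply: cvgM; exact: Xc.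
    - by apply: cvgM; [apply: cvgMr; exact: Xc|exact: Yc].
    - by apply: cvgMr; apply: cvgM; exact: Yc.
  apply: (@pnorm_cvg _ _ hN (fun t => K t * X t - c) (fun t => K t * Y t - d)).
    by apply: cvgB; [apply: cvgM; [exact: Kc|exact: Xc]|exact: cvg_cst].
  by apply: cvgB; [apply: cvgM; [exact: Kc|exact: Yc]|exact: cvg_cst].
have -> : N (k * a - c) (k * b - d) = G 0.
  by rewrite /G /K /X /Y !mul0r !addr0.
apply/eqP; apply: contrapT => /negP neq.
have e0 : 0 < `|G 0 - N c d| by rewrite normr_gt0 subr_eq0.
have /cvgrPdist_lt /(_ _ e0) := contG.
move=> /nbhs_ballP[delta /= delta0 near0].
have [t td Gt] := dense _ delta0.
have := near0 t; rewrite /ball /= sub0r normrN => /(_ td).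
by rewrite Gt ltxx.
Qed.

(** The reflection across the line of the sum of two vectors of equal form exchanges them. If the
    sum is zero, the vectors are opposite. *)
Lemma lorch_norm_eq (R : realType) (N : R -> R -> R)
    (hN : planar_norm N) (hL : lorch_property N) (A B C a b c d : R) :
  maximal_form N A B C ->
  quadratic_form A B C a b = quadratic_form A B C c d -> N a b = N c d.
Proof.
move=> hm qE.
have [ab0|ab0] := ltP 0 ((a + c) ^+ 2 + (b + d) ^+ 2); last first.
  have [a0 b0] := sum_sqr_le0 ab0.
  have -> : a = - c by lra.
  have -> : b = - d by lra.
  exact: pnormN.
have := maximal_form_reflection hN hL c d hm ab0.
have -> : 2 * polar_form A B C c d (a + c) (b + d) =
    quadratic_form A B C (a + c) (b + d).
  have -> : quadratic_form A B C (a + c) (b + d) =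
    2 * polar_form A B C c d (a + c) (b + d) +
    (quadratic_form A B C a b - quadratic_form A B C c d).
    by rewrite /polar_form /quadratic_form; ring.
  by rewrite qE subrr addr0.
rewrite divff; last by rewrite gt_eqF// (quadratic_form_gt0 hm).
by rewrite /= !mul1r !addrK.
Qed.

(** By [lorch_norm_eq] every vector has the norm of the multiple of (1, 0) on which the form takes
    the same value; homogeneity then makes the squared norm proportional to the form. *)
Lemma lorch_quadratic (R : realType) (N : R -> R -> R)
    (hN : planar_norm N) (hL : lorch_property N) :
  exists A B C, forall a b, N a b ^+ 2 = quadratic_form A B C a b.
Proof.
have [A [B [C hm]]] := exists_maximal_form hN.
have [A0 _] := maximal_form_gt0 hm.
pose m := N 1 0 ^+ 2 / A.
exists (m * A), (m * B), (m * C) => a b.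
have -> : quadratic_form (m * A) (m * B) (m * C) a b =
    m * quadratic_form A B C a b by rewrite /quadratic_form; ring.
have [ab|/sum_sqr_le0[-> ->]] := ltP 0 (a ^+ 2 + b ^+ 2); last first.
  have := pnormZ hN 0 0 0; rewrite mulr0 normr0 mul0r => ->.
  by rewrite /quadratic_form; ring.
have Q0 := quadratic_form_gt0 hm ab.
pose l := Num.sqrt (quadratic_form A B C a b / A).
have l2 : l ^+ 2 = quadratic_form A B C a b / A.
  by rewrite sqr_sqrtr// divr_ge0 ?ltW.
have -> : N a b = N (l * 1) (l * 0).
  apply: (lorch_norm_eq hN hL hm).
  rewrite [RHS]/quadratic_form mulr1 mulr0 l2; field.
  by rewrite gt_eqF.
by rewrite pnormZ// exprMn real_normK ?num_real// l2 /m; ring.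
Qed.

(** * From planes to the whole space: the inner product by polarization *)

Lemma planar_norm_span (R : realType) (X : normedModType R) (x y : X) :
  (forall a b : R, a *: x + b *: y = 0 -> a = 0 /\ b = 0) ->
  planar_norm (fun a b : R => `|a *: x + b *: y|).
Proof.
move=> free; split.
- by [].
- by move=> k a b; rewrite -!scalerA -scalerDr normrZ.
- by move=> a b c d; rewrite !scalerDl addrACA; exact: ler_normD.
- by move=> a b /eqP; rewrite normr_eq0 => /eqP; exact: free.
- move=> f g t fc gc; apply: cvg_norm; apply: cvgD.
  + by apply: cvgZr_tmp; exact: fc.
  + by apply: cvgZr_tmp; exact: gc.
Qed.

Lemma plane_quadratic (R : realType) (X : normedModType R) :
  (forall (u v : X) (r : R), 0 < r -> `|u| = `|v| ->
     `|u + v| <= `|r *: u + r^-1 *: v|) ->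
  forall x y : X, exists A B C : R, forall a b : R,
    `|a *: x + b *: y| ^+ 2 = quadratic_form A B C a b.
Proof.
move=> hL x y.
have [free|] := pselect (forall a b : R, a *: x + b *: y = 0 -> a = 0 /\ b = 0).
  apply: (lorch_quadratic (planar_norm_span free)).
  move=> a b c d r r0 eqN.
  have := hL _ _ _ r0 eqN.
  by rewrite !scalerDr !scalerDl !scalerA addrACA (addrACA ((r * a) *: x)).
(* For dependent vectors the span is at most a line, where the squared norm is visibly quadratic:
   either x = 0 or y is a multiple of x. *)
move=> /existsNP[a /existsNP[b]].
rewrite not_implyE => -[rel /not_andP nz].
have [b0|b0] := eqVneq b 0.
  have a0 : a != 0 by apply/eqP => a0; case: nz => nz; apply: nz.
  have -> : x = 0.
    move/eqP: rel; rewrite b0 scale0r addr0 scaler_eq0 (negbTE a0) /=.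
    by move/eqP.
  exists 0, 0, (`|y| ^+ 2) => c d.
  rewrite scaler0 add0r normrZ exprMn real_normK ?num_real//.
  by rewrite /quadratic_form; ring.
have -> : y = (- (a / b)) *: x.
  apply: (scalerI b0); rewrite scalerA mulrN mulrCA divff// mulr1 scaleNr.
  by apply/eqP; rewrite -addr_eq0 addrC rel.
set k := - (a / b).
exists (`|x| ^+ 2), (k * `|x| ^+ 2), (k ^+ 2 * `|x| ^+ 2) => c d.
rewrite scalerA -scalerDl normrZ exprMn real_normK ?num_real//.
by rewrite /quadratic_form; ring.
Qed.

Section JordanVonNeumann.
Context (R : realType) (X : normedModType R).
Hypothesis quad : forall x y : X, exists A B C : R, forall a b : R,
  `|a *: x + b *: y| ^+ 2 = quadratic_form A B C a b.

Let sqn (x : X) : R := `|x| ^+ 2.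

Definition polarization (x y : X) : R := (`|x + y| ^+ 2 - `|x| ^+ 2 - `|y| ^+ 2) / 2.

Let sqn_parallelogram x y : sqn (x + y) + sqn (x - y) = 2 * (sqn x + sqn y).
Proof.
have [A [B [C h]]] := quad x y.
have := h 1 1; have := h 1 (- 1); have := h 1 0; have := h 0 1.
rewrite !scale1r !scale0r scaleN1r addr0 add0r /sqn => -> -> -> ->.
by rewrite /quadratic_form; ring.
Qed.

Let polarizationC x y : polarization x y = polarization y x.
Proof. by rewrite /polarization (addrC x); ring. Qed.

(** Three vectors occur, beyond the reach of a single plane, so additivity comes from the
    parallelogram law: h1 + h2 - h3 eliminates the norms of x + y - z and x - y + z, and h4 replaces
    that of y - z. *)
Let polarizationDr x y z :
  polarization x (y + z) = polarization x y + polarization x z.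
Proof.
have h1 := sqn_parallelogram (x + z) y.
have h2 := sqn_parallelogram (x + y) z.
have h3 := sqn_parallelogram x (y - z).
have h4 := sqn_parallelogram y z.
rewrite (addrAC x z y) in h1.
rewrite addrA opprB addrA (addrAC x z (- y)) in h3.
rewrite (addrAC x z (- y)) in h1.
rewrite /polarization addrA -!/(sqn _).
lra.
Qed.

(** Only two vectors occur, so homogeneity is read off the quadratic form on their plane. *)
Let polarizationZr k x y : polarization x (k *: y) = k * polarization x y.
Proof.
have [A [B [C h]]] := quad x y.
have := h 1 k; have := h 0 k; have := h 1 1; have := h 1 0; have := h 0 1.
rewrite /polarization !scale1r !scale0r !addr0 !add0r => -> -> -> -> ->.
by rewrite /quadratic_form; field.
Qed.

Let polarizationBr x : zmod_morphism (polarization x).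
Proof.
move=> y z; rewrite polarizationDr; congr (_ + _).
by rewrite -scaleN1r polarizationZr mulN1r.
Qed.

Let polarizationBl x : zmod_morphism (polarization ^~ x).
Proof. by move=> y z; rewrite !(polarizationC _ x) polarizationBr. Qed.

Let polarizationZl x : scalable_for *%R (polarization ^~ x).
Proof. by move=> k y /=; rewrite !(polarizationC _ x) polarizationZr. Qed.

Let polarizationZr' x : scalable_for (idfun \; *%R) (polarization x).
Proof. by move=> k y /=; rewrite polarizationZr. Qed.

Let polarization_sqr x : `|x| ^+ 2 = polarization x x.
Proof.
rewrite /polarization -mulr2n -scaler_nat normrZ normr_nat exprMn.
by field.
Qed.

Let polarization_herm x y :
  polarization x y = (-1) ^+ false * idfun (polarization y x).
Proof. by rewrite expr0 mul1r /= polarizationC. Qed.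

Let polarization_gt0 x : x != 0 -> 0 < polarization x x.
Proof. by move=> x0; rewrite -polarization_sqr exprn_gt0// normr_gt0. Qed.

HB.instance Definition _ := isBilinear.Build R X X R *%R (idfun \; *%R)
  polarization polarizationBl polarizationBr polarizationZl polarizationZr'.
HB.instance Definition _ := isHermitianSesquilinear.Build R X false idfun
  polarization polarization_herm.
HB.instance Definition _ := isDotProduct.Build R X polarization polarization_gt0.

Lemma quadratic_inner_product_space : is_inner_product_space X.
Proof.
by exists (polarization : {dot X for idfun}) => x; exact: polarization_sqr.
Qed.

End JordanVonNeumann.

(** * From the angular distance inequality to Lorch's condition *)

Lemma angular_contraction (R : realType) (X : normedModType R) (p q : R)
    (u v : X) (t : R) : 0 < q ->
  (forall x y : X, x != 0 -> y != 0 ->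
      angular_distance p x y <=
        2 `^ (1 / q) *
        (`|x - y| /
         (`|x| `^ ((1 - p) * q) + `|y| `^ ((1 - p) * q)) `^ (1 / q))) ->
  `|u| = `|v| ->
  `|expR (p * t) *: u + expR (- (p * t)) *: v| <=
  `|expR t *: u + expR (- t) *: v|.
Proof.
move=> q0 hq uv; have [u0|u0] := eqVneq u 0.
  have -> : v = 0 by apply/eqP; rewrite -normr_eq0 -uv u0 normr0.
  by rewrite u0 !scaler0.
set n := `|u|; have n0 : 0 < n by rewrite normr_gt0.
have v0 : v != 0 by rewrite -normr_gt0 -uv.
have x0 : expR t *: u != 0 by rewrite scaler_eq0 negb_or u0 gt_eqF// expR_gt0.
have y0 : - (expR (- t) *: v) != 0.
  by rewrite oppr_eq0 scaler_eq0 negb_or v0 gt_eqF// expR_gt0.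
have powE s : (expR s * n) `^ (1 - p) = expR (s * (1 - p)) * n `^ (1 - p).
  by rewrite powRM ?expR_ge0 ?(ltW n0)// expRM.
have := hq _ _ x0 y0; rewrite /angular_distance.
rewrite normrN !normrZ !(ger0_norm (expR_ge0 _)) -uv -/n !(powRrM _ (1 - p)) !powE.
set m := n `^ (1 - p); have m0 : 0 < m by rewrite powR_gt0.
rewrite !opprK scalerN opprK !scalerA.
(* Normalizing by the power 1 - p leaves the exponent p s, whence the contraction factor [p]. *)
have coef s : (expR (s * (1 - p)) * m)^-1 * expR s = m^-1 * expR (p * s).
  rewrite invfM -expRN mulrAC -expRD mulrC; congr (_ * expR _); ring.
rewrite !coef -!scalerA -scalerDr normrZ gtr0_norm ?invr_gt0// mulrN.
rewrite -[X in X <= _]mulrC ler_pdivrMr// => /le_trans; apply.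
set w := `|_|.
(* The two terms on the right have product m^(2q), since the exponentials are inverse to each other;
   this is the arithmetic-geometric inequality. *)
have amgm : 2 * m `^ q <= (expR (t * (1 - p)) * m) `^ q + (expR (- t * (1 - p)) * m) `^ q.
  rewrite !powRM ?expR_ge0 ?(ltW m0)// -!expRM -mulrDl ler_wpM2r ?powR_ge0//.
  set s := t * (1 - p) * q.
  have -> : - t * (1 - p) * q = - s by rewrite /s; ring.
  have ss : expR s * expR (- s) = 1 by rewrite -expRD subrr expR0.
  have -> : expR s + expR (- s) = 2 + expR (- s) * (expR s - 1) ^+ 2.
    transitivity (expR s * (expR s * expR (- s)) + 2 * (1 - expR s * expR (- s))
      + expR (- s)); first by rewrite ss; ring.
    by ring.
  by rewrite lerDl mulr_ge0 ?sqr_ge0// expR_ge0.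
have q1 : 0 <= 1 / q by rewrite divr_ge0// ltW.
have bound := ge0_ler_powR q1 _ _ amgm.
have {}bound : 2 `^ (1 / q) * m <=
  ((expR (t * (1 - p)) * m) `^ q + (expR (- t * (1 - p)) * m) `^ q) `^ (1 / q).
  apply: le_trans (bound _ _).
  - rewrite powRM ?powR_ge0// -powRrM mulrCA divff ?gt_eqF// mulr1 powRr1//.
    exact: ltW.
  - by rewrite nnegrE mulr_ge0// powR_ge0.
  - by rewrite nnegrE addr_ge0// powR_ge0.
have t0 : 0 < 2 `^ (1 / q) :> R by rewrite powR_gt0.
move: bound; set D := (_ `^ q + _) `^ _ => bound.
have D0 : 0 < D by apply: lt_le_trans bound; rewrite mulr_gt0.
set z := 2 `^ _ in bound *.
have -> : z * (w / D) * m = w * (z * m / D) by ring.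
by rewrite ler_piMr ?normr_ge0// ler_pdivrMr// mul1r.
Qed.

Lemma contraction_lorch (R : realType) (X : normedModType R) (p : R) (u v : X) :
  0 <= p < 1 ->
  (forall t, `|expR (p * t) *: u + expR (- (p * t)) *: v| <=
             `|expR t *: u + expR (- t) *: v|) ->
  forall r : R, 0 < r -> `|u + v| <= `|r *: u + r^-1 *: v|.
Proof.
move=> /andP[p0 p1] contr r r0.
pose F t := `|expR t *: u + expR (- t) *: v|.
have FE : F (ln r) = `|r *: u + r^-1 *: v| by rewrite /F expRN lnK.
have F0 : F 0 = `|u + v| by rewrite /F oppr0 expR0 !scale1r.
(* In the parameter t = ln r one use of the hypothesis multiplies t by [p]; iterating drives it to 0
   because 0 <= p < 1. *)
have Fn n : F (p ^+ n * ln r) <= F (ln r).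
  elim: n => [|n IH]; first by rewrite mul1r.
  by apply: le_trans IH; rewrite exprS -mulrA; exact: contr.
rewrite -FE -F0.
have Fc : {for 0, continuous F}.
  apply: cvg_norm; apply: cvgD; apply: cvgZr_tmp.
    exact: continuous_expR.
  by apply: continuous_comp; [exact: opp_continuous|exact: continuous_expR].
have lim0 : ((fun n => p ^+ n * ln r) @ \oo --> (0 : R))%classic.
  rewrite -(mul0r (ln r)); apply: cvgMl.
  by apply: cvg_expr; rewrite ger0_norm.
have limF : ((fun n => F (p ^+ n * ln r)) @ \oo --> F 0)%classic.
  exact: (cvg_comp _ _ lim0 Fc).
by apply: (cvgr_to_le limF); apply: nearW => n; exact: Fn.
Qed.

Theorem theorem2p5 (R : realType) (X : normedModType R) (p : R)
  (hp : 0 <= p < 1)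
  (hq : exists q : R, 0 < q /\
    forall x y : X, x != 0 -> y != 0 ->
      angular_distance p x y <=
        2 `^ (1 / q) *
        (`|x - y| /
         (`|x| `^ ((1 - p) * q) + `|y| `^ ((1 - p) * q)) `^ (1 / q))) :
  is_inner_product_space X.
Proof.
have [q [q0 hang]] := hq.
apply: quadratic_inner_product_space; apply: plane_quadratic => u v r r0 uv.
apply: (contraction_lorch hp) => // t.
exact: (angular_contraction t q0 hang uv).
Qed.
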